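(* Let $(X,\mathcal{R}_\mu,\mu)$ and $(Y,\mathcal{R}_\nu,\nu)$ be probability spaces (with values in a complete non-Archimedean valued field $K$), and let $T:X\to X$ and $S:Y\to Y$ be invertible measure preserving transformations. If $T$ and $S$ are conjugate, then they are spectrally isomorphic.
   Context: Let $K$ be a complete non-Archimedean valued field with absolute value $|\cdot|$. For a set $X$, a covering ring is a collection $\mathcal{R}\subseteq\mathcal{P}(X)$ that covers $X$ and is closed under $A\cap B$, $A\cup B$, $A\setminus B$. It is separating if for all distinct $x,y\in X$ there is $A\in\mathcal{R}$ with $x\in A$, $y\notin A$; it is an algebra if $X\in\mathcal{R}$. All covering rings are assumed separating. The $\mathcal{R}$-topology is the topology on $X$ with basis $\mathcal{R}$. A subcollection $\mathcal{A}\subset\mathcal{R}$ is shrinking if the intersection of any two elements of $\mathcal{A}$ contains an element of $\mathcal{A}$. A measure is a map $\mu:\mathcal{R}\to K$ that is additive on disjoint sets, bounded (for every $A\in\mathcal{R}$ the set $\{\mu(B):B\in\mathcal{R},B\subset A\}$ is bounded), and continuous (if $\mathcal{A}\subset\mathcal{R}$ is shrinking with $\bigcap_{A\in\mathcal{A}}A=\emptyset$, then for every $\epsilon>0$ there is $A_0\in\mathcal{A}$ with $|\mu(A)|<\epsilon$ for every $A\in\mathcal{A}$ contained in $A_0$). Put $\|A\|_\mu=\sup\{|\mu(B)|:B\in\mathcal{R},B\subset A\}$, $N_\mu(x)=\inf\{\|U\|_\mu:U\in\mathcal{R},x\in U\}$, and $X_0(\mu)=\{x\in X:N_\mu(x)=0\}$.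 For $f:X\to K$ put $\|f\|_\mu=\sup_{x\in X}|f(x)|N_\mu(x)$. Step functions are finite $K$-linear combinations of indicator functions $\chi_A$, $A\in\mathcal{R}$; the integral is the linear functional on step functions with $\int\chi_A\,d\mu=\mu(A)$; $f$ is integrable if there are step functions $f_n$ with $\|f_n-f\|_\mu\to0$, and the integral extends by continuity. $L(\mu)$ is the space of integrable functions, and $L^1(\mu)$ is $L(\mu)$ modulo equality outside a subset of $X_0(\mu)$, with the norm induced by $\|\cdot\|_\mu$. $\mathcal{R}_\mu$ is the collection of sets $A\subset X$ with $\chi_A$ integrable; it is a covering ring containing $\mathcal{R}$ and all subsets of $X_0(\mu)$, and $\mu$ extends to it by $\mu(A)=\int\chi_A\,d\mu$. The triple $(X,\mathcal{R}_\mu,\mu)$ is a probability space if $\mathcal{R}$ is an algebra and $\mu(X)=1$. A measure preserving transformation is a map $T:X\to X$ that is continuous for the $\mathcal{R}_\mu$-topology and satisfies $\mu(T^{-1}B)=\mu(B)$ for all $B\in\mathcal{R}_\mu$; it is invertible if it is a homeomorphism and $\mu(TB)=\mu(B)$ for all $B\in\mathcal{R}_\mu$. A measure algebra isomorphism $\Phi:(\mathcal{R}_\mu,\mu)\to(\mathcal{R}_\nu,\nu)$ is a bijection $\mathcal{R}_\mu\to\mathcal{R}_\nu$ preserving complements and unions with $\nu(\Phi(B))=\mu(B)$ for all $B\in\mathcal{R}_\mu$. $T$ and $S$ are conjugate if there is a measure algebra isomorphism $\Phi:(\mathcal{R}_\mu,\mu)\to(\mathcal{R}_\nu,\nu)$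 with $\Phi^{-1}\circ S^{-1}=T^{-1}\circ\Phi^{-1}$ (where $T^{-1},S^{-1}$ denote taking preimages of sets). $U_T:L^1(\mu)\to L^1(\mu)$ is $f\mapsto f\circ T$, and similarly $U_S$ on $L^1(\nu)$. Invertible measure preserving $T$ and $S$ are spectrally isomorphic if there is an invertible linear isometry $W:L^1(\mu)\to L^1(\nu)$ with $U_S\circ W=W\circ U_T$. *)

(* Defs.v *)
(* Conventions.
   - Real numbers are an abstract [R : realType].
   - A measure on a covering ring [C] is a total function [set X -> K] of which
     only the values on [C] matter.
   - [L1 mu] is the quotient of the K-vector space of integrable functions by
     the subspace of the functions vanishing outside [X0 mu]. *)
From HB Require Import structures.
From mathcomp Require Import all_boot all_order all_algebra.
From mathcomp Require Import generic_quotient ring_quotient.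
From mathcomp Require Import mathcomp_extra boolp classical_sets functions.
From mathcomp Require Import reals ereal topology normedtype sequences numfun.
From mathcomp Require Import measurable_structure.

Set Implicit Arguments.
Unset Strict Implicit.
Unset Printing Implicit Defensive.
Import Order.TTheory GRing.Theory Num.Theory.
Import numFieldNormedType.Exports.
Local Open Scope classical_set_scope.
Local Open Scope ring_scope.

(* The absolute value may be trivial. *)
Record complete_absval (R : realType) (K : fieldType) := CompleteAbsval {
  absval :> K -> R;
  absval_ge0 : forall x, 0 <= absval x;
  absval_eq0 : forall x, absval x = 0 <-> x = 0;
  absvalM : forall x y, absval (x * y) = absval x * absval y;
  absval_ultra : forall x y, absval (x + y) <= Num.max (absval x) (absval y);
  absval_complete : forall u : nat -> K,
    (forall e, 0 < e -> exists N : nat, forall m n : nat,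
       (N <= m)%N -> (N <= n)%N -> absval (u m - u n) < e) ->
    exists l, absval (u n - l) @[n --> \oo] --> (0 : R) }.

Record covering_ring (X : Type) := CoveringRing {
  cring : set (set X);
  cring_cover : \bigcup_(A in cring) A = [set: X];
  cringI : setI_closed cring;
  cringU : setU_closed cring;
  cringD : setD_closed cring;
  cring_separating : forall x y : X, x <> y ->
    exists A, [/\ cring A, A x & ~ A y] }.

Definition is_algebra (X : Type) (C : covering_ring X) : Prop :=
  cring C [set: X].

Definition basis_open (X : Type) (B : set (set X)) (U : set X) : Prop :=
  forall x, U x -> exists A, [/\ B A, A x & A `<=` U].

Definition basis_continuous (X Y : Type) (B : set (set X)) (C : set (set Y))
    (f : X -> Y) : Prop :=
  forall U, basis_open C U -> basis_open B (f @^-1` U).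

Definition shrinking (X : Type) (F : set (set X)) : Prop :=
  forall A B, F A -> F B -> exists D, F D /\ D `<=` A `&` B.

Record na_measure (R : realType) (K : fieldType) (v : complete_absval R K)
    (X : Type) (C : covering_ring X) := NaMeasure {
  na_mu :> set X -> K;
  na_mu_additive : forall A B, cring C A -> cring C B -> A `&` B = set0 ->
    na_mu (A `|` B) = na_mu A + na_mu B;
  na_mu_bounded : forall A, cring C A ->
    has_ubound [set v (na_mu B) | B in [set B | cring C B /\ B `<=` A]];
  na_mu_continuous : forall F : set (set X), F `<=` cring C -> shrinking F ->
    \bigcap_(A in F) A = set0 -> forall e, 0 < e ->
    exists A0, F A0 /\ forall A, F A -> A `<=` A0 -> v (na_mu A) < e }.

Section Integration.
Context (R : realType) (K : fieldType) (v : complete_absval R K).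
Context (X : Type) (C : covering_ring X) (mu : na_measure v C).

(* Meant for [A] in the ring, where the supremum exists by boundedness. *)
Definition set_norm (A : set X) : R :=
  sup [set v (mu B) | B in [set B | cring C B /\ B `<=` A]].

Definition Nmu (x : X) : R :=
  inf [set set_norm U | U in [set U | cring C U /\ U x]].

Definition X0 : set X := [set x | Nmu x = 0].

(* The supremum is taken in [0, +oo]: adding 0 only matters for empty X. *)
Definition fun_norm (f : X -> K) : \bar R :=
  ereal_sup (0%E |` [set (v (f x) * Nmu x)%:E | x in [set: X]]).

Definition is_step_integral (f : X -> K) (w : K) : Prop :=
  exists (n : nat) (c : 'I_n -> K) (A : 'I_n -> set X),
    [/\ forall i, cring C (A i),
        f = (fun x => \sum_(i < n) c i * \1_(A i) x)
      & w = \sum_(i < n) c i * mu (A i)].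

Definition is_step (f : X -> K) : Prop := exists w, is_step_integral f w.

Definition is_integrable (f : X -> K) : Prop :=
  exists g : nat -> X -> K,
    (forall n, is_step (g n)) /\ fun_norm (g n - f) @[n --> \oo] --> 0%E.

Definition is_integral (f : X -> K) (w : K) : Prop :=
  exists (g : nat -> X -> K) (u : nat -> K),
    [/\ forall n, is_step_integral (g n) (u n),
        fun_norm (g n - f) @[n --> \oo] --> 0%E
      & v (u n - w) @[n --> \oo] --> (0 : R)].

(* The value [w] in [is_integral f w] does not depend on the approximating step
   functions, nor on the way they are written, because the integral of a step
   function [g] is bounded in absolute value by [fun_norm g]; [xget] only
   names it. *)
Definition integral (f : X -> K) : K := xget 0 [set w | is_integral f w].

Definition Rmu : set (set X) := [set A | is_integrable \1_A].

Definition mu_ext (A : set X) : K := integral \1_A.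

Definition is_probability : Prop := is_algebra C /\ mu [set: X] = 1.

(* [mu_ext] is a map on [Rmu], so an equation on a preimage or an image
   includes the claim that this set is in [Rmu]. *)
Definition measure_preserving (T : X -> X) : Prop :=
  basis_continuous Rmu Rmu T /\
  forall B, Rmu B -> Rmu (T @^-1` B) /\ mu_ext (T @^-1` B) = mu_ext B.

Definition invertible_measure_preserving (T : X -> X) : Prop :=
  [/\ measure_preserving T,
      (exists T' : X -> X,
        [/\ cancel T T', cancel T' T & basis_continuous Rmu Rmu T'])
    & forall B, Rmu B -> Rmu (T @` B) /\ mu_ext (T @` B) = mu_ext B].

Lemma absval0 : v 0 = 0.
Proof. exact/absval_eq0. Qed.

Lemma absval1 : v 1 = 1.
Proof.
have v1 : v 1 != 0 by apply/eqP => /absval_eq0/eqP; rewrite oner_eq0.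
by apply: (mulfI v1); rewrite -absvalM !mulr1.
Qed.

Lemma absvalN x : v (- x) = v x.
Proof.
apply/eqP; rewrite -(@eqrXn2 _ 2) ?absval_ge0 //.
by rewrite !expr2 -!absvalM mulrNN.
Qed.

Lemma set_norm_ge0 A : cring C A -> 0 <= set_norm A.
Proof.
move=> CA; apply: (le_trans (absval_ge0 v (mu A))).
apply: (ub_le_sup (na_mu_bounded mu CA)).
by exists A => //; split.
Qed.

Lemma Nmu_ge0 x : 0 <= Nmu x.
Proof.
apply: lb_le_inf.
  have : [set: X] x by [].
  by rewrite -(cring_cover C) => -[U CU Ux]; exists (set_norm U), U.
by move=> _ [U [CU _] <-]; exact: set_norm_ge0.
Qed.

Lemma fun_norm_ge0 f : (0 <= fun_norm f)%E.
Proof. by apply: ereal_sup_ubound; left. Qed.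

Lemma fun_norm_ge f x : ((v (f x) * Nmu x)%:E <= fun_norm f)%E.
Proof. by apply: ereal_sup_ubound; right; exists x. Qed.

Lemma fun_norm0 : fun_norm 0 = 0%E.
Proof.
apply/eqP; rewrite eq_le fun_norm_ge0 andbT.
apply: ge_ereal_sup => y [->//|[x _ <-]].
by rewrite absval0 mul0r.
Qed.

Lemma fun_norm_linear (a : K) (f g : X -> K^o) :
  (fun_norm (a *: f + g)%R <= (v a)%:E * fun_norm f + fun_norm g)%E.
Proof.
have va := absval_ge0 v a.
apply: ge_ereal_sup => y [->|[x _ <-]].
  by rewrite adde_ge0 ?mule_ge0 ?fun_norm_ge0.
apply: (@le_trans _ _ ((v a)%:E * (v (f x) * Nmu x)%:E + (v (g x) * Nmu x)%:E)%E).
  rewrite -EFinM -EFinD lee_fin mulrA -absvalM -mulrDl.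
  apply: ler_wpM2r; first exact: Nmu_ge0.
  apply: le_trans (absval_ultra _ _ _) _.
  by rewrite ge_max lerDl lerDr !absval_ge0.
by apply: leeD; rewrite ?fun_norm_ge //; apply: lee_wpmul2l; rewrite ?fun_norm_ge.
Qed.

Lemma is_step0 : is_step 0.
Proof.
exists 0, 0%N, (fun=> 0), (fun=> set0); split; first by case.
- by apply/funext => x; rewrite big_ord0.
- by rewrite big_ord0.
Qed.

Lemma is_step_linear (a : K) (f g : X -> K^o) :
  is_step f -> is_step g -> is_step (a *: f + g).
Proof.
move=> [_ [p [c [A [CA -> _]]]]] [_ [q [d [B [CB -> _]]]]].
pose e i := match fintype.split i with inl i => a * c i | inr j => d j end.
pose D i := match fintype.split i with inl i => A i | inr j => B j end.
exists (\sum_(i < p + q) e i * mu (D i)), (p + q)%N, e, D; split=> //.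
  by move=> i; rewrite /D; case: (fintype.split i).
apply/funext => x; rewrite big_split_ord /=.
have -> : \sum_(i < p) e (lshift q i) * \1_(D (lshift q i)) x =
    a * \sum_(i < p) c i * \1_(A i) x.
  rewrite mulr_sumr; apply: eq_bigr => i _.
  by rewrite /e /D (unsplitK (inl i)) mulrA.
have -> // : \sum_(j < q) e (rshift p j) * \1_(D (rshift p j)) x =
    \sum_(j < q) d j * \1_(B j) x.
by apply: eq_bigr => j _; rewrite /e /D (unsplitK (inr j)).
Qed.

Definition integrable_fun : {pred X -> K^o} :=
  mem [set f | is_integrable f].

Lemma integrable_submod_closed : submod_closed integrable_fun.
Proof.
split.
  rewrite inE /=; exists (fun=> 0); split; first by move=> n; exact: is_step0.
  by rewrite subr0 fun_norm0; exact: cvg_cst.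
move=> a f g; rewrite !inE /= => -[F [sF cF]] [G [sG cG]].
pose H n : X -> K^o := a *: (F n : X -> K^o) + G n.
exists H; split; first by move=> n; exact: is_step_linear.
have e n : H n - (a *: f + g) = a *: ((F n : X -> K^o) - f) + (G n - g).
  by rewrite scalerBr opprD addrACA.
apply: (@squeeze_cvge _ _ _ _ (cst 0%E) _
  (fun n => (v a)%:E * fun_norm (F n - f)%R + fun_norm (G n - g)%R)%E).
- by apply: nearW => n; rewrite fun_norm_ge0 e fun_norm_linear.
- exact: cvg_cst.
rewrite [X in _ --> X](_ : _ = (v a)%:E * 0 + 0)%E; last by rewrite mule0 adde0.
apply: cvgeD => //.
exact: cvgeZl.
Qed.

HB.instance Definition _ := GRing.isSubmodClosed.Build _ _ integrable_fun
  integrable_submod_closed.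

Record Lmu := MkLmu { Lmu_val :> X -> K^o; _ : Lmu_val \in integrable_fun }.

HB.instance Definition _ := [isSub for Lmu_val].
HB.instance Definition _ := [Choice of Lmu by <:].
HB.instance Definition _ := [SubChoice_isSubLmodule of Lmu by <:].

Definition null_fun : {pred Lmu} :=
  mem [set f : Lmu | [set x | f x != 0] `<=` X0].

Lemma null_submod_closed : submod_closed null_fun.
Proof.
split; first by rewrite inE /= => x /=; rewrite eqxx.
move=> a f g; rewrite !inE /= => f0 g0 x /= fg; apply: contrapT => Nx.
have fx : Lmu_val f x = 0 by apply: contrapT => /eqP/f0.
have gx : Lmu_val g x = 0 by apply: contrapT => /eqP/g0.
by move: fg; rewrite [X in X != _](_ : _ = a * f x + g x) // fx gx mulr0 addr0 eqxx.
Qed.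

HB.instance Definition _ := GRing.isSubmodClosed.Build _ _ null_fun
  null_submod_closed.

Definition L1 : Type := Quotient.quot null_fun.

HB.instance Definition _ := GRing.Zmodule.on L1.
HB.instance Definition _ := EqQuotient.on L1.

Local Open Scope quotient_scope.

Definition L1_scale (a : K) (f : L1) : L1 := \pi_L1 (a *: repr f).

Lemma pi_L1_eq (f g : Lmu) :
  (\pi_L1 f = \pi_L1 g) <-> ([set x | f x != g x] `<=` X0).
Proof.
split=> [/eqP|fg]; last first.
  apply/eqP; rewrite -Quotient.idealrBE inE /= => x /= fgx; apply: fg => /=.
  by rewrite -subr_eq0.
rewrite -Quotient.idealrBE inE /= => fg x /= fgx; apply: fg => /=.
by rewrite subr_eq0.
Qed.

Lemma pi_L1_scale a (f : Lmu) : L1_scale a (\pi_L1 f) = \pi_L1 (a *: f).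
Proof.
apply/eqP; rewrite -Quotient.idealrBE -scalerBr rpredZ //.
by rewrite Quotient.idealrBE reprK.
Qed.

Lemma L1_scaleA a b f : L1_scale a (L1_scale b f) = L1_scale (a * b) f.
Proof.
by elim/quotW: f => f; rewrite (pi_L1_scale b f) !pi_L1_scale scalerA.
Qed.

Lemma L1_scale1 : left_id 1 L1_scale.
Proof. by elim/quotW=> f; rewrite pi_L1_scale scale1r. Qed.

Lemma L1_scaleDr : right_distributive L1_scale +%R.
Proof.
move=> a; elim/quotW=> f; elim/quotW=> g; rewrite !pi_L1_scale.
by rewrite -!(raddfD \pi_L1) /= pi_L1_scale scalerDr.
Qed.

Lemma L1_scaleDl f : {morph L1_scale^~ f : a b / a + b}.
Proof.
move=> a b; elim/quotW: f => f; rewrite !pi_L1_scale.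
by rewrite -!(raddfD \pi_L1) /= scalerDl.
Qed.

HB.instance Definition _ := GRing.Zmodule_isLmodule.Build K L1
  L1_scaleA L1_scale1 L1_scaleDr L1_scaleDl.

Definition L1_norm (f : L1) : \bar R := fun_norm (repr f : Lmu).

Lemma L1_norm_pi (f : Lmu) : L1_norm (\pi_L1 f) = fun_norm f.
Proof.
have /pi_L1_eq fE : \pi_L1 (repr (\pi_L1 f)) = \pi_L1 f by rewrite reprK.
congr (ereal_sup (_ |` _)); apply: eq_imagel => x _; congr EFin.
have [->//|/fE] := eqVneq ((repr (\pi_L1 f) : Lmu) x) (f x).
by rewrite /X0 /= => ->; rewrite !mulr0.
Qed.

(* The default value 0 of [insubd] is used only if the composite with [T] is
   not integrable, which does not happen for invertible measure preserving
   [T]. *)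
Definition koopman (T : X -> X) (f : L1) : L1 :=
  \pi_L1 (insubd (0 : Lmu) ((repr f : Lmu) \o T)).

End Integration.

Section Isomorphisms.
Context (R : realType) (K : fieldType) (v : complete_absval R K).
Context (X Y : Type) (C : covering_ring X) (D : covering_ring Y).
Context (mu : na_measure v C) (nu : na_measure v D).

Definition measure_algebra_iso (Phi : set X -> set Y) : Prop :=
  [/\ set_bij (Rmu mu) (Rmu nu) Phi,
      forall A, Rmu mu A -> Phi (~` A) = ~` Phi A,
      forall A B, Rmu mu A -> Rmu mu B -> Phi (A `|` B) = Phi A `|` Phi B
    & forall B, Rmu mu B -> mu_ext nu (Phi B) = mu_ext mu B].

Definition conjugate (T : X -> X) (S : Y -> Y) : Prop :=
  exists2 Phi, measure_algebra_iso Phi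
    & forall B, Rmu nu B ->
        pinv (Rmu mu) Phi (S @^-1` B) = T @^-1` (pinv (Rmu mu) Phi B).

Definition spectrally_isomorphic (T : X -> X) (S : Y -> Y) : Prop :=
  exists W : {linear L1 mu -> L1 nu},
    [/\ bijective W,
        forall f, L1_norm (W f) = L1_norm f
      & koopman S \o W =1 W \o koopman T].

End Isomorphisms.

(* Main.v *)
(* The seminorm is intrinsic to the measure algebra: for [A] in [Rmu mu], the
   supremum of [Nmu mu] over [A] is the supremum of the absolute values of the
   measures of the subsets of [A] in [Rmu mu].  Hence a measure algebra
   isomorphism [Phi] preserves this quantity, and for [y] with [Nmu nu y != 0]
   the ultrafilter of the [A] with [y] in [Phi A] converges, by continuity of
   [mu], to a point [phi y] with [Nmu nu y <= Nmu mu (phi y)].  The spectral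
   isomorphism is composition with [phi]; its inverse is composition with the
   point map of [Phi^-1], and [phi (S y) = T (phi y)] outside the null set. *)
Require Import Defs.
From HB Require Import structures.
From mathcomp Require Import all_boot all_order all_algebra.
From mathcomp Require Import generic_quotient ring_quotient.
From mathcomp Require Import mathcomp_extra boolp classical_sets functions.
From mathcomp Require Import reals ereal topology normedtype sequences numfun.
From mathcomp Require Import measurable_structure.
Set Implicit Arguments.
Unset Strict Implicit.
Unset Printing Implicit Defensive.
Import Order.TTheory GRing.Theory Num.Theory.
Import numFieldNormedType.Exports.
Local Open Scope classical_set_scope.
Local Open Scope ring_scope.

(** * Ultrametric estimates for the absolute value *)

Section AbsVal.
Context (R : realType) (K : fieldType) (v : complete_absval R K).

Lemma absvalB_le (x y : K) (e : R) : v x <= e -> v y <= e -> v (x - y) <= e.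
Proof.
by move=> xe ye; rewrite (le_trans (absval_ultra _ _ _))// absvalN ge_max xe.
Qed.

Lemma absval_subC (x y : K) : v (x - y) = v (y - x).
Proof. by rewrite -absvalN opprB. Qed.

End AbsVal.

(** * The norm of a ring set and the pointwise function [Nmu] *)

Section MeasureTheory.
Context (R : realType) (K : fieldType) (v : complete_absval R K).
Context (X : Type) (C : covering_ring X) (mu : na_measure v C).
Local Notation N := (Nmu mu).

Lemma Nmu_le_set_norm U x : cring C U -> U x -> N x <= set_norm mu U.
Proof.
move=> CU Ux; apply: ge_inf; last by exists U.
by exists 0 => _ [V [CV _] <-]; exact: set_norm_ge0.
Qed.

Lemma Nmu_lt x s : N x < s -> exists U, [/\ cring C U, U x & set_norm mu U < s].
Proof.
move=> /inf_lt[|_ [U [CU Ux] <-] ltU]; last by exists U.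
have : [set: X] x by [].
by rewrite -(cring_cover C) => -[U CU Ux]; exists (set_norm mu U), U.
Qed.

Lemma absval_mu_le_set_norm A B : cring C A -> cring C B -> B `<=` A ->
  v (mu B) <= set_norm mu A.
Proof.
by move=> CA CB BA; apply: (ub_le_sup (na_mu_bounded mu CA)); exists B.
Qed.

Lemma cring_set0 (x : X) : cring C set0.
Proof.
have : [set: X] x by [].
by rewrite -(cring_cover C) => -[U CU Ux]; rewrite -(setDv U); exact: cringD.
Qed.

Lemma na_mu0 : cring C set0 -> mu set0 = 0.
Proof.
move=> C0; have := na_mu_additive mu C0 C0 (setI0 set0).
by rewrite setU0 => /eqP; rewrite -subr_eq subrr => /eqP.
Qed.

Lemma na_muID A B : cring C A -> cring C B ->
  mu A = mu (A `&` B) + mu (A `\` B).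
Proof.
move=> CA CB; rewrite -na_mu_additive.
- by rewrite setUIDK.
- by apply: cringI.
- by apply: cringD.
- by rewrite setDE setIACA setICr setI0.
Qed.

Lemma set_norm_le A s : cring C A -> (forall B, cring C B -> B `<=` A ->
  v (mu B) <= s) ->
  set_norm mu A <= s.
Proof.
move=> CA sA; apply: ge_sup; first by exists (v (mu A)), A => //; split.
by move=> _ [B [CB BA] <-]; exact: sA.
Qed.

(** A ring subset of the union splits into its part in [A] and the rest, which lies in [B]; the
    ultrametric inequality takes the larger of the two values, not their sum. *)
Lemma set_normU A B s : cring C A -> cring C B ->
  set_norm mu A < s -> set_norm mu B < s -> set_norm mu (A `|` B) < s.
Proof.
move=> CA CB As Bs.
apply: (@le_lt_trans _ _ (Num.max (set_norm mu A) (set_norm mu B))); last first.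
  by rewrite gt_max As.
apply: set_norm_le; first exact: cringU.
move=> D CD DAB; rewrite (na_muID CD CA).
rewrite (le_trans (absval_ultra _ _ _)) // ge_max !le_max; apply/andP; split.
  by apply/orP; left; apply: absval_mu_le_set_norm => //; apply: cringI.
apply/orP; right; apply: absval_mu_le_set_norm => // [|x [/DAB[]//]].
by apply: cringD.
Qed.

(* The sets [B `\` U], [U] of norm less than [s], shrink to the empty set, so
   that one of them has measure less than [s]. *)
Lemma absval_mu_le_Nmu B s : cring C B -> (forall x, B x -> N x <= s) ->
  0 <= s ->
  v (mu B) <= s.
Proof.
move=> CB Bs s0; apply/ler_addgt0Pr => e e0;
  have se0 : 0 < s + e by exact: ltr_wpDl.
have [[x0 _]|/set0P/negP/negPn/eqP B0] := pselect (exists x, B x); last first.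
  rewrite B0 na_mu0 -?B0 // absval0; exact: ltW.
pose F := [set B `\` U | U in [set U | cring C U /\ set_norm mu U < s + e]].
have C0 := cring_set0 x0.
have FB : F B.
  exists set0; rewrite ?setD0 //; split=> //.
  apply: le_lt_trans se0; apply: set_norm_le => // D _; rewrite subset0 => ->.
  by rewrite na_mu0 // absval0.
have FC : F `<=` cring C.
  by move=> _ [U [CU _] <-]; apply: cringD.
have sF : shrinking F.
  move=> _ _ [U [CU Us] <-] [V [CV Vs] <-].
  exists (B `\` (U `|` V)); split; last by move=> x [Bx /not_orP[]].
  by exists (U `|` V) => //; split; [apply: cringU|apply: set_normU].
have F0 : \bigcap_(A in F) A = set0.
  rewrite -subset0 => x Fx; have Bx := Fx _ FB.
  have /Nmu_lt[U [CU Ux Us]] :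
    N x < s + e by rewrite (le_lt_trans (Bs _ Bx)) // ltrDl.
  by have [|_ /(_ Ux)] := Fx (B `\` U); first by exists U.
have [_ [[U [CU Us] <-]]] := na_mu_continuous mu FC sF F0 se0.
move=> /(_ (B `\` U)) BU.
rewrite (na_muID CB CU) (le_trans (absval_ultra _ _ _)) // ge_max.
apply/andP; split; last by apply/ltW/BU => //; exists U.
rewrite (le_trans _ (ltW Us)) // absval_mu_le_set_norm //; apply: cringI => //.
Qed.

Lemma set_norm_gt A s : cring C A -> s < set_norm mu A ->
  exists B, [/\ cring C B, B `<=` A & s < v (mu B)].
Proof.
move=> CA sA; have [_ [B [CB BA] <-] ltB] : exists2 z,
    [set v (mu B) | B in [set B | cring C B /\ B `<=` A]] z & s < z.
  by apply: sup_gt => //; exists (v (mu A)), A => //; split.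
by exists B.
Qed.

(** This bounds a step integral by the seminorm, with [c] and [B] added for the induction: splitting
    [B] along the first set adds its coefficient to [c] inside that set and keeps [c] outside. When
    no set is left, [absval_mu_le_Nmu] applies with the bound [s / v c]. *)
Lemma cst_step_integral_le n (c : K) (B : set X) (a : 'I_n -> K)
    (A : 'I_n -> set X) (s : R) :
  cring C B -> (forall i, cring C (A i)) -> 0 <= s ->
  (forall x, B x -> v (c + \sum_(i < n) a i * \1_(A i) x) * N x <= s) ->
  v (c * mu B + \sum_(i < n) a i * mu (A i `&` B)) <= s.
Proof.
move=> CB CA s0; elim: n => [|n IH] in c B a A CB CA *.
  rewrite big_ord0 addr0 absvalM.
  have [->|c0] := eqVneq c 0; first by rewrite absval0 mul0r.
  have vc : 0 < v c.
    by rewrite lt_def absval_ge0 andbT; apply/eqP => /absval_eq0/eqP;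
      apply/negP.
  move=> Bs; rewrite mulrC -ler_pdivlMr //; apply: absval_mu_le_Nmu => //.
    by move=> x Bx; rewrite ler_pdivlMr // mulrC; have := Bs x Bx;
      rewrite big_ord0 addr0.
  by rewrite divr_ge0 // ltW.
move=> Bs; rewrite big_ord_recl.
set A0 := A ord0; pose A' i := A (lift ord0 i); pose a' i := a (lift ord0 i).
have CA0 : cring C A0 by exact: CA.
have CI : cring C (B `&` A0) by apply: cringI.
have CD : cring C (B `\` A0) by apply: cringD.
have -> : c * mu B + (a ord0 * mu (A0 `&` B) +
      \sum_(i < n) a' i * mu (A' i `&` B)) =
    ((c + a ord0) * mu (B `&` A0) + \sum_(i < n) a' i * mu (A' i `&` (B `&`
      A0))) +
    (c * mu (B `\` A0) + \sum_(i < n) a' i * mu (A' i `&` (B `\` A0))).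
  rewrite addrACA -big_split /= (na_muID CB CA0) (setIC A0) addrA;
    congr (_ + _).
    by rewrite mulrDl mulrDr addrAC.
  apply: eq_bigr => i _; rewrite -mulrDr; congr (_ * _).
  rewrite (@na_muID (A' i `&` B) A0) //; last by apply: cringI => //; exact: CA.
  by rewrite setIA setDE setIA -setDE.
rewrite (le_trans (absval_ultra _ _ _)) // ge_max; apply/andP; split;
  apply: IH => //.
- by move=> i; exact: CA.
- move=> x [Bx Ax]; have := Bs x Bx;
    rewrite big_ord_recl (indicE K (A ord0)) mem_set //.
  by rewrite mulr1 addrA.
- by move=> i; exact: CA.
- move=> x [Bx Ax]; have := Bs x Bx;
    rewrite big_ord_recl (indicE K (A ord0)) memNset //.
  by rewrite mulr0 add0r.
Qed.

End MeasureTheory.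

(** * Integrable functions, the extended ring and the extended measure *)

Section Integrals.
Context (R : realType) (K : fieldType) (v : complete_absval R K).
Context (X : Type) (C : covering_ring X) (mu : na_measure v C).
Local Notation N := (Nmu mu).

(** For [e >= 0] this says that the difference of the two indicators has seminorm at most [e], since
    its values have absolute value 0 or 1. *)
Definition Nmu_close (e : R) (A B : set X) : Prop :=
  forall x, e < N x -> (A x <-> B x).

Lemma step_integralB f g w u : is_step_integral mu f w ->
  is_step_integral mu g u -> is_step_integral mu (fun x => f x - g x) (w - u).
Proof.
move=> [p [c [A [CA -> ->]]]] [q [d [B [CB -> ->]]]].
pose e i := match fintype.split i with inl i => c i | inr j => - d j end.
pose D i := match fintype.split i with inl i => A i | inr j => B j end.
have eD (F : set X -> K) : \sum_(i < p + q) e i * F (D i) =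
    \sum_(i < p) c i * F (A i) - \sum_(i < q) d i * F (B i).
  rewrite big_split_ord /= -sumrN; congr (_ + _); apply: eq_bigr => i _.
    by rewrite /e /D (unsplitK (inl i)).
  by rewrite /e /D (unsplitK (inr i)) mulNr.
exists (p + q)%N, e, D; split.
- by move=> i; rewrite /D; case: (fintype.split i).
- by apply/funext => x; rewrite (eD (fun Z => \1_Z x)).
- by rewrite eD.
Qed.

Lemma step_integral_indic A : cring C A -> is_step_integral mu \1_A (mu A).
Proof.
move=> CA; exists 1%N, (fun=> 1), (fun=> A); split=> //.
  by apply/funext => x; rewrite big_ord1 mul1r.
by rewrite big_ord1 mul1r.
Qed.

Lemma is_step_indic A : cring C A -> is_step mu \1_A.
Proof. by move=> CA; exists (mu A); exact: step_integral_indic. Qed.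

Lemma fun_norm_leP f (M : R) : 0 <= M ->
  (fun_norm mu f <= M%:E)%E <-> (forall x, v (f x) * N x <= M).
Proof.
move=> M0; split=> [fM x|fM].
  by rewrite -lee_fin; apply: le_trans fM; exact: fun_norm_ge.
by apply: ge_ereal_sup => y [->//|[x _ <-]]; rewrite lee_fin.
Qed.

Lemma cvg_fun_norm0 (g : nat -> X -> K) (f : X -> K) :
  fun_norm mu (g n - f) @[n --> \oo] --> 0%E <->
  (forall e, 0 < e -> \forall n \near \oo, forall x,
    v (g n x - f x) * N x <= e).
Proof.
split=> [cg e e0|cg].
  have : \forall n \near \oo, (fun_norm mu (g n - f)%R < e%:E)%E.
    exact: (cg _ (@nbhs_open_ereal_lt _ 0 (fun=> e) e0)).
  apply: filterS => n /ltW gn x.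
  by have /fun_norm_leP := gn; apply; exact: ltW.
apply/fine_cvgP; split.
  apply: filterS (cg 1 ltr01) => n gn.
  rewrite ge0_fin_numE ?fun_norm_ge0 //; apply: le_lt_trans (ltry 1).
  exact/fun_norm_leP.
apply/cvgrPdist_le => e e0; apply: filterS (cg e e0) => n gn /=.
have gne : (fun_norm mu (g n - f)%R <= e%:E)%E by apply/fun_norm_leP => //;
  exact: ltW.
rewrite sub0r normrN ger0_norm ?fine_ge0 ?fun_norm_ge0 // -lee_fin fineK //.
by rewrite ge0_fin_numE ?fun_norm_ge0 // (le_lt_trans gne) ?ltry.
Qed.

Lemma near_invS_lt (e : R) : 0 < e -> \forall n \near \oo, n.+1%:R^-1 < e.
Proof. by move=> e0; have := near_infty_natSinv_lt (PosNum e0). Qed.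

Lemma absval_ultraB (x y z : K) (r M : R) : 0 <= r ->
  v (x - y) * r <= M -> v (y - z) * r <= M -> v (x - z) * r <= M.
Proof.
move=> r0 xyM yzM; have -> : x - z = (x - y) + (y - z) by rewrite addrA subrK.
have := absval_ultra v (x - y) (y - z); rewrite le_max => /orP[] h.
  by apply: le_trans xyM; rewrite ler_wpM2r.
by apply: le_trans yzM; rewrite ler_wpM2r.
Qed.

Lemma integrableP f : is_integrable mu f <-> (forall e, 0 < e ->
  exists g, is_step mu g /\ forall x, v (g x - f x) * N x <= e).
Proof.
split=> [[g [sg /cvg_fun_norm0 cg]] e e0|h].
  by have [n _ /(_ n (leqnn n))] := cg e e0; exists (g n).
have /choice[g gP] : forall n : nat, exists g, is_step mu g /\
    forall x, v (g x - f x) * N x <= n.+1%:R^-1.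
  by move=> n; apply: h; rewrite invr_gt0.
exists g; split; first by move=> n; case: (gP n).
apply/cvg_fun_norm0 => e e0; apply: filterS (near_invS_lt e0) => n ne x.
by apply: le_trans (ltW ne); have [_] := gP n.
Qed.

(** The integrable functions are closed for the seminorm, so that approximants built on [Rmu] may
    replace step functions. *)
Lemma integrable_approx f : (forall e, 0 < e -> exists g, is_integrable mu g /\
  forall x, v (g x - f x) * N x <= e) -> is_integrable mu f.
Proof.
move=> h; apply/integrableP => e e0;
  have [g [/integrableP/(_ e e0)[k [sk kg]] gf]] := h e e0.
exists k; split=> // x; apply: (absval_ultraB (y := g x)) => //; exact: Nmu_ge0.
Qed.

Lemma absval_indic_le1 (A : set X) x : v (\1_A x) <= 1.
Proof. by rewrite indicE; case: (_ \in _); rewrite ?absval1 ?absval0. Qed.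

Lemma Nmu_close_indic e A B x : 0 <= e -> Nmu_close e A B ->
  v (\1_A x - \1_B x) * N x <= e.
Proof.
move=> e0 AB; have [eN|Ne] := ltP e (N x).
  suff -> : \1_A x = \1_B x :> K by rewrite subrr absval0 mul0r.
  rewrite !indicE; have -> // : (x \in A) = (x \in B).
  by apply/idP/idP; rewrite !inE; apply AB.
rewrite (le_trans _ Ne) // ler_piMl ?Nmu_ge0 //.
by apply: absvalB_le; exact: absval_indic_le1.
Qed.

Hypothesis CT : is_algebra C.

Lemma step_integral_le f w (M : R) : is_step_integral mu f w -> 0 <= M ->
  (forall x, v (f x) * N x <= M) -> v w <= M.
Proof.
move=> [n [c [A [CA -> ->]]]] M0 fM.
have := @cst_step_integral_le _ _ _ _ _ mu n 0 _ c A M CT CA M0.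
rewrite mul0r add0r => h; under eq_bigr do rewrite -[A _]setIT; apply: h => x _.
by rewrite add0r.
Qed.

(** In the induction the constant [b] collects the coefficients of those sets already treated that
    contain the point. *)
Lemma cring_step_preimage f (P : set K) : is_step mu f -> cring C (f @^-1` P).
Proof.
move=> [_ [n [c [A [CA -> _]]]]].
suff h : forall b : K, cring C [set x | P (b + \sum_(i < n) c i * \1_(A i) x)].
  by have := h 0; congr (cring C _); apply/seteqP; split=> x /=; rewrite add0r.
elim: n => [|n IH] in c A CA * => b.
  have [Pb|Pb] := pselect (P b).
    by rewrite [X in cring C X](_ : _ = setT) //; apply/seteqP;
      split=> x //= _; rewrite big_ord0 addr0.
  rewrite [X in cring C X](_ : _ = setT `\` setT); first by apply: cringD.
  by rewrite setDv; apply/seteqP; split=> x //=; rewrite big_ord0 addr0.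
have CA' i : cring C (A (lift ord0 i)) by exact: CA.
have Pb b' := IH (fun i => c (lift ord0 i)) (fun i => A (lift ord0 i)) CA' b'.
have := cringU (cringI (Pb (b + c ord0)) (CA ord0)) (cringD (Pb b) (CA ord0)).
congr (cring C _); apply/seteqP; split=> x /=.
  by move=> [|] [Px Ax]; rewrite big_ord_recl (indicE K (A ord0))
    ?(mem_set Ax) ?(memNset Ax) ?mulr1 ?mulr0 ?add0r ?addrA.
rewrite big_ord_recl (indicE K (A ord0)).
have [Ax|Ax] := pselect (A ord0 x).
  by rewrite mem_set // mulr1 addrA => ?; left.
by rewrite memNset // mulr0 add0r => ?; right.
Qed.

(** If a step function [g] is within [e] of [\1_A], then [v (g x - \1_A x) < 1] wherever [e < N x].
    There [A] agrees with the ring set given by [v (g x - 1) < 1], as [v (g x)] and [v (g x - 1)]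
    cannot both be below 1. *)
Lemma RmuP A : Rmu mu A <-> forall e, 0 < e ->
  exists B, cring C B /\ Nmu_close e A B.
Proof.
split=> [/integrableP h e e0|h].
  have [g [sg gA]] := h e e0.
  exists (g @^-1` [set k | v (k - 1) < 1]); split;
    first exact: cring_step_preimage.
  move=> x eN; have vg : v (g x - \1_A x) < 1.
    have N0 : 0 < N x by exact: lt_trans eN.
    by rewrite -(ltr_pM2r N0) mul1r (le_lt_trans (gA x)).
  split=> [Ax|]; rewrite /=; first by move: vg; rewrite indicE mem_set.
  move=> g1; apply: contrapT => Ax; move: vg;
    rewrite indicE memNset // subr0 => vg.
  suff : v 1 < 1 by rewrite absval1 ltxx.
  have -> : 1 = g x - (g x - 1) by rewrite opprB addrC subrK.
  by rewrite (le_lt_trans (absval_ultra _ _ _)) // absvalN gt_max vg.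
apply/integrableP => e e0; have [B [CB AB]] := h e e0.
exists \1_B; split; first exact: is_step_indic.
by move=> x; rewrite absval_subC; apply: Nmu_close_indic => //; exact: ltW.
Qed.

(** For large [n] the step function [g n - \1_B] has seminorm at most [e + d], hence so has its
    integral [u n - mu B] in absolute value, and [u n] is that close to [w]. *)
Lemma integral_close A B w e : is_integral mu \1_A w -> cring C B -> 0 <= e ->
  Nmu_close e A B -> v (w - mu B) <= e.
Proof.
move=> [g [u [gu /cvg_fun_norm0 cg cu]]] CB e0 AB.
apply/ler_addgt0Pr => d d0; have ed : 0 < e + d by exact: ltr_wpDl.
have cu' : \forall n \near \oo, v (u n - w) <= e + d.
  move/cvgrPdist_le : cu => /(_ _ ed); apply: filterS => n.
  by rewrite sub0r normrN ger0_norm // absval_ge0.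
have [n [un gn]] := filter_ex (filterI cu' (cg _ ed)).
have -> : w - mu B = (u n - mu B) - (u n - w) by rewrite opprB [RHS]addrC
  subrKA.
apply: absvalB_le => //.
apply: (step_integral_le (step_integralB (gu n) (step_integral_indic CB))).
  exact: ltW.
move=> x; apply: (absval_ultraB (y := \1_A x)) => //; first exact: Nmu_ge0.
by rewrite (le_trans (Nmu_close_indic _ e0 AB)) // lerDl ltW.
Qed.

Lemma mu_close A B e : cring C A -> cring C B -> 0 <= e -> Nmu_close e A B ->
  v (mu A - mu B) <= e.
Proof.
move=> CA CB e0 AB; apply: (step_integral_le (step_integralB
  (step_integral_indic CA) (step_integral_indic CB))) => // x.
exact: Nmu_close_indic.
Qed.

(** Ring sets agreeing with [A] where [N] exceeds [n.+1%:R^-1] have measures forming a Cauchy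
    sequence; completeness of [K] gives the value of the integral. *)
Lemma mu_ext_is_integral A : Rmu mu A -> is_integral mu \1_A (mu_ext mu A).
Proof.
move=> /RmuP RA; apply: (@xgetPex _ 0 [set w | is_integral mu \1_A w]).
have /choice[B BP] : forall n :
  nat, exists B, cring C B /\ Nmu_close n.+1%:R^-1 A B.
  by move=> n; apply: RA; rewrite invr_gt0.
have [e e0|l cl] := @absval_complete _ _ v (fun n => mu (B n)).
  have [n0 _ n0P] := near_invS_lt e0; exists n0 => m n n0m n0n.
  (* Where [N] exceeds the larger of the two radii, both [B m] and [B n] agree with [A], hence with
     each other. *)
  have [i ilt iP] : exists2 r : R, r < e & m.+1%:R^-1 <= r /\ n.+1%:R^-1 <= r.
    exists (Num.max m.+1%:R^-1 n.+1%:R^-1); first by rewrite gt_max !n0P.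
    by rewrite !le_max !lexx orbT.
  case: iP => mi ni; apply: le_lt_trans ilt;
    have [[CBm mP] [CBn nP]] := (BP m, BP n).
  apply: mu_close => //; first by rewrite (le_trans _ mi) // invr_ge0.
  move=> x ix; have [mx nx] :=
    (mP x (le_lt_trans mi ix), nP x (le_lt_trans ni ix)).
  tauto.
exists l, (fun n => \1_(B n)), (fun n => mu (B n)); split=> //.
  by move=> n; apply: step_integral_indic; case: (BP n).
apply/cvg_fun_norm0 => e e0; apply: filterS (near_invS_lt e0) => n ne x.
rewrite absval_subC (le_trans _ (ltW ne)) //; apply: Nmu_close_indic.
  by rewrite invr_ge0.
by case: (BP n).
Qed.

Lemma mu_ext_close A B e : Rmu mu A -> cring C B -> 0 <= e -> Nmu_close e A B ->
  v (mu_ext mu A - mu B) <= e.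
Proof. by move=> /mu_ext_is_integral; exact: integral_close. Qed.

Lemma Rmu_cring A : cring C A -> Rmu mu A.
Proof. by move=> CA; apply/RmuP => e _; exists A. Qed.

Lemma RmuC A : Rmu mu A -> Rmu mu (~` A).
Proof.
move=> /RmuP RA; apply/RmuP => e e0; have [B [CB AB]] := RA e e0.
exists (setT `\` B); split; first by apply: cringD.
by move=> x /AB h; rewrite setTD; split=> /= ? /h.
Qed.

Lemma RmuI A B : Rmu mu A -> Rmu mu B -> Rmu mu (A `&` B).
Proof.
move=> /RmuP RA /RmuP RB; apply/RmuP => e e0.
have [[A' [CA AA]] [B' [CB BB]]] := (RA e e0, RB e e0).
exists (A' `&` B'); split; first by apply: cringI.
by move=> x /[dup] /AA ? /BB ?; rewrite /setI /=; tauto.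
Qed.

Lemma RmuU A B : Rmu mu A -> Rmu mu B -> Rmu mu (A `|` B).
Proof.
by move=> /RmuC RA /RmuC RB; rewrite -[_ `|` _]setCK setCU; apply/RmuC/RmuI.
Qed.

Lemma Rmu_Nmu0 A B : Rmu mu A -> (forall x, N x != 0 -> (A x <-> B x)) ->
  Rmu mu B.
Proof.
move=> /RmuP RA AB; apply/RmuP => e e0; have [A' [CA AA]] := RA e e0.
exists A'; split=> // x eN; have := AA x eN.
by have := AB x; rewrite gt_eqF ?(lt_trans e0) // => /(_ isT); tauto.
Qed.

(** A ring set agreeing with [A] where [N] exceeds [s + e] contains no such point, because [A]
    contains none; so the bound for ring sets applies. *)
Lemma mu_ext_le_Nmu A s : Rmu mu A -> 0 <= s -> (forall x, A x -> N x <= s) ->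
  v (mu_ext mu A) <= s.
Proof.
move=> RA s0 As; apply/ler_addgt0Pr => e e0;
  have se : 0 < s + e by exact: ltr_wpDl.
have /RmuP/(_ _ se)[B [CB AB]] := RA.
rewrite -[mu_ext mu A](subrK (mu B)) (le_trans (absval_ultra _ _ _)) // ge_max.
apply/andP; split; first by apply: mu_ext_close => //; exact: ltW.
apply: absval_mu_le_Nmu => // [x Bx|]; last exact: ltW.
have [//|sN] := leP (N x) (s + e).
rewrite -(AB _ sN) in Bx.
by have := lt_le_trans sN (As _ Bx); rewrite gtrDl ltNge ltW.
Qed.

(** A ring set [U] agreeing with [A] where [N] exceeds [r] contains [x], so it has a ring subset [B]
    of measure larger than [r]. Cutting [B] down to [A] changes the measure by at most [r], which by
    the ultrametric inequality cannot bring it down to [r]. *)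
Lemma lt_Nmu_mu_ext A x r : Rmu mu A -> A x -> 0 < r -> r < N x ->
  exists B, [/\ Rmu mu B, B `<=` A & r < v (mu_ext mu B)].
Proof.
move=> RA Ax r0 rN; have /RmuP/(_ _ r0)[U [CU AU]] := RA.
have Ux : U x by exact/(AU _ rN).
have [|B [CB BU rB]] := @set_norm_gt _ _ _ _ _ mu U r CU.
  exact: lt_le_trans (Nmu_le_set_norm mu CU Ux).
have RBA : Rmu mu (B `&` A) by apply: RmuI => //; exact: Rmu_cring.
exists (B `&` A); split=> //.
rewrite ltNge; apply/negP => le_r; move: rB; apply/negP; rewrite -leNgt.
have -> : mu B = mu_ext mu (B `&` A) - (mu_ext mu (B `&` A) - mu B).
  by rewrite opprB addrC subrK.
apply: absvalB_le => //; apply: mu_ext_close => //; first exact: ltW.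
by move=> y /AU h; split=> [[]//|By]; split=> //; apply/h/BU.
Qed.

End Integrals.

(** * Composition with a point map as a contraction of [L1] spaces *)

Section Pullback.
Context (R : realType) (K : fieldType) (v : complete_absval R K).
Context (X Y : Type) (C : covering_ring X) (D : covering_ring Y).
Context (mu : na_measure v C) (nu : na_measure v D).
Hypotheses (CT : is_algebra C) (DT : is_algebra D).

Local Open Scope quotient_scope.

(** If [Nmu nu y] were larger, some [U] around [x] would have norm below a number [r < Nmu nu y],
    while [A] has a subset of measure larger than [r], whose counterpart in [U] has the same
    measure. *)
Lemma Nmu_le_transport x y :
  (forall U, cring C U -> U x -> exists A, [/\ Rmu nu A, A y &
     forall B, Rmu nu B -> B `<=` A -> exists B', [/\ Rmu mu B', B' `<=` U &
       mu_ext mu B' = mu_ext nu B]]) ->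
  Nmu nu y <= Nmu mu x.
Proof.
move=> h; rewrite leNgt; apply/negP => lt_xy.
have [U [CU Ux Uy]] := Nmu_lt lt_xy.
have [A [RA Ay AP]] := h U CU Ux.
have [Ur rN] := midf_lt Uy; set r := _ / _ in Ur rN.
have r0 : 0 < r by apply: le_lt_trans Ur; exact: set_norm_ge0.
have [B [RB BA]] := lt_Nmu_mu_ext DT RA Ay r0 rN.
have [B' [RB' B'U <-]] := AP B RB BA.
apply/negP; rewrite -leNgt (mu_ext_le_Nmu CT) //; first exact: ltW.
by move=> z /B'U Uz; rewrite (le_trans (Nmu_le_set_norm mu CU Uz)) // ltW.
Qed.

(** This has the form of [koopman], for a map between two spaces. The default 0 is avoided when [h]
    satisfies [Nmu_nondecreasing_map], by [integrable_comp]. *)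
Definition pullback (h : Y -> X) (f : L1 mu) : L1 nu :=
  \pi_(L1 nu) (insubd (0 : Lmu nu) ((repr f : Lmu mu) \o h)).

(** The first condition makes composites of step functions integrable. The second makes composition
    a contraction and puts the preimage of the null set inside the null set, so that classes are
    respected. *)
Definition Nmu_nondecreasing_map (h : Y -> X) : Prop :=
  (forall A, cring C A -> Rmu nu (h @^-1` A)) /\
  (forall y, Nmu nu y <= Nmu mu (h y)).

Variable h : Y -> X.
Hypothesis hP : Nmu_nondecreasing_map h.

Lemma integrable_comp f : is_integrable mu f -> is_integrable nu (f \o h).
Proof.
case: hP => hR hN /integrableP fP; apply: integrable_approx => e e0.
have [g [[_ [n [c [A [CA gE _]]]]] gf]] := fP e e0.
exists (g \o h); split; last first.
  by move=> y; rewrite (le_trans _ (gf (h y))) //= ler_wpM2l // absval_ge0.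
have : \sum_(i < n) c i *: (\1_(h @^-1` (A i)) : Y ->
  K^o) \in integrable_fun nu.
  by apply: rpred_sum => i _; apply: rpredZ; rewrite inE /=; exact: hR.
rewrite inE /=; congr is_integrable; apply/funext => y.
by rewrite fct_sumE gE.
Qed.

Lemma Lmu_comp (f : Lmu mu) : exists g : Lmu nu, forall y, g y = f (h y).
Proof.
have fh : (f \o h : Y -> K^o) \in integrable_fun nu.
  by rewrite inE /=; apply: integrable_comp; case: f => f /=; rewrite inE.
by exists (MkLmu fh).
Qed.

Lemma pullback_pi (f : Lmu mu) (g : Lmu nu) :
  (forall y, Nmu nu y != 0 -> g y = f (h y)) ->
  pullback h (\pi_(L1 mu) f) = \pi_(L1 nu) g.
Proof.
move=> gf; apply/pi_L1_eq => y /= gy; apply: contrapT => /eqP Ny.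
have fE : \pi_(L1 mu) (repr (\pi_(L1 mu) f)) = \pi_(L1 mu) f by rewrite reprK.
move: gy; rewrite gf // val_insubd.
have -> : ((repr (\pi_(L1 mu) f) : Lmu mu) \o h : Y ->
  K^o) \in integrable_fun nu.
  by rewrite inE /=; apply: integrable_comp; case: (repr _) => k /=;
    rewrite inE.
(* Two representatives can differ at [h y] only if [h y] is null, and then [y] is null. *)
move=> /(proj1 (pi_L1_eq _ _) fE (h y)) Nh.
have := proj2 hP y; rewrite Nh => N0.
by case/negP: Ny; rewrite eq_le N0 Nmu_ge0.
Qed.

Lemma pullback_linear : linear (pullback h).
Proof.
move=> a; elim/quotW=> f; elim/quotW=> g.
have [[f' fE] [g' gE]] := (Lmu_comp f, Lmu_comp g).
have -> : a *: \pi_(L1 mu) f + \pi_(L1 mu) g = \pi_(L1 mu) (a *: f + g).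
  by rewrite raddfD /= -pi_L1_scale.
rewrite (@pullback_pi f f') // (@pullback_pi g g') //.
rewrite (@pullback_pi (a *: f + g) (a *: f' + g')).
  by rewrite raddfD /= -pi_L1_scale.
move=> y _; rewrite [LHS](_ : _ = a *: f' y + g' y) //.
by rewrite fE gE.
Qed.

Lemma L1_norm_pullback f : (L1_norm (pullback h f) <= L1_norm f)%E.
Proof.
elim/quotW: f => f; have [g gE] := Lmu_comp f.
rewrite (@pullback_pi f g) // !L1_norm_pi.
apply: ge_ereal_sup => _ [->|[y _ <-]]; first exact: fun_norm_ge0.
apply: le_trans (fun_norm_ge mu f (h y)); rewrite lee_fin gE.
by rewrite ler_wpM2l ?absval_ge0 //; exact: proj2 hP y.
Qed.

End Pullback.

Section PullbackComp.
Context (R : realType) (K : fieldType) (v : complete_absval R K).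
Context (X Y Z : Type).
Context (C : covering_ring X) (D : covering_ring Y) (E : covering_ring Z).
Context (mu : na_measure v C) (nu : na_measure v D) (la : na_measure v E).
Local Open Scope quotient_scope.

Lemma pullback_comp (h : Y -> X) (k : Z -> Y) (f : Lmu mu) (g : Lmu la) :
  Nmu_nondecreasing_map mu nu h -> Nmu_nondecreasing_map nu la k ->
  (forall z, Nmu la z != 0 -> g z = f (h (k z))) ->
  pullback la k (pullback nu h (\pi_(L1 mu) f)) = \pi_(L1 la) g.
Proof.
move=> hP kP gf; have [f' fE] := Lmu_comp hP f.
rewrite (@pullback_pi _ _ _ _ _ _ _ _ _ _ hP f f') //.
by apply: pullback_pi => // z Nz; rewrite gf // fE.
Qed.

End PullbackComp.

(** * Invertible measure preserving maps and probability spaces *)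

Section MeasurePreserving.
Context (R : realType) (K : fieldType) (v : complete_absval R K).
Context (X : Type) (C : covering_ring X) (mu : na_measure v C).

(** A subset [B] of the preimage of [U] is transported to its image, a subset of [U] of the same
    measure. *)
Lemma invertible_Nmu_nondecreasing (T : X -> X) : is_algebra C ->
  invertible_measure_preserving mu T -> Nmu_nondecreasing_map mu mu T.
Proof.
move=> CT [[_ mT] _ iT]; split=> [A CA|x];
  first by case: (mT A (Rmu_cring mu CT CA)).
apply: Nmu_le_transport => // U CU UTx;
  have [RU _] := mT U (Rmu_cring mu CT CU).
exists (T @^-1` U); split=> // B RB BU; have [RTB muTB] := iT B RB.
by exists (T @` B); split=> // _ [y By <-]; exact: BU.
Qed.

(** A point is wanted as the value of the point maps on the null set. *)
Lemma probability_inhabited : is_probability mu -> exists _ : X, True.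
Proof.
move=> [CT mu1]; apply: contrapT => X0.
have T0 : [set: X] = set0 by apply/seteqP; split=> x // _; apply: X0; exists x.
have := na_mu0 mu; rewrite -T0 => /(_ CT)/eqP; apply/negP.
by rewrite mu1 oner_eq0.
Qed.

End MeasurePreserving.

(** * The point map induced by a measure algebra isomorphism *)

Section PointMap.
Context (R : realType) (K : fieldType) (v : complete_absval R K).
Context (X Y : Type) (C : covering_ring X) (D : covering_ring Y).
Context (mu : na_measure v C) (nu : na_measure v D).
Hypotheses (CT : is_algebra C) (DT : is_algebra D).

Lemma measure_algebra_iso_inv Phi : measure_algebra_iso mu nu Phi ->
  measure_algebra_iso nu mu (pinv (Rmu mu) Phi).
Proof.
move=> [[fP iP sP] PC PU Pmu]; set Psi := pinv _ _.
have PhiK A : Rmu mu A -> Psi (Phi A) = A.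
  by move=> RA; apply: pinvKV; rewrite ?inE //; exact: iP.
have ex B : Rmu nu B -> exists2 A, Rmu mu A & Phi A = B by exact: sP.
split.
- split.
  + by move=> _ /ex[A RA <-]; rewrite PhiK.
  + move=> A B; rewrite !inE => /ex[A' RA <-] /ex[B' RB <-].
    by rewrite !PhiK // => ->.
  + by move=> A RA; exists (Phi A); [exact: fP|rewrite PhiK].
- move=> _ /ex[A RA <-]; rewrite -PC // !PhiK //; exact: RmuC.
- move=> _ _ /ex[A RA <-] /ex[B RB <-]; rewrite -PU // !PhiK //; exact: RmuU.
- by move=> _ /ex[A RA <-]; rewrite PhiK // Pmu.
Qed.

Variable Phi : set X -> set Y.
Hypothesis PhiP : measure_algebra_iso mu nu Phi.

Definition induces_iso (phi : Y -> X) : Prop := forall y, Nmu nu y != 0 ->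
  forall A, Rmu mu A -> (A (phi y) <-> Phi A y).

Lemma iso_Rmu A : Rmu mu A -> Rmu nu (Phi A).
Proof. by case: PhiP => -[fP _ _] _ _ _; exact: fP. Qed.

Lemma isoC A : Rmu mu A -> Phi (~` A) = ~` Phi A.
Proof. by case: PhiP => _ + _ _; exact. Qed.

Lemma isoI A B : Rmu mu A -> Rmu mu B -> Phi (A `&` B) = Phi A `&` Phi B.
Proof.
case: PhiP => _ _ PU _ RA RB; have [RA' RB'] := (RmuC CT RA, RmuC CT RB).
rewrite -[A `&` B]setCK setCI isoC; last exact: RmuU.
by rewrite PU // !isoC // setCU !setCK.
Qed.

Lemma iso_pinvK A : Rmu mu A -> pinv (Rmu mu) Phi (Phi A) = A.
Proof. by case: PhiP => -[_ iP _] _ _ _ RA; apply: pinvKV; rewrite ?inE. Qed.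

(** With [B = Phi B'], the sets [B'] and its intersection with [A] have the same image, so
    injectivity gives the inclusion. *)
Lemma iso_subset A B : Rmu mu A -> Rmu nu B -> B `<=` Phi A ->
  exists B', [/\ Rmu mu B', B' `<=` A & mu_ext mu B' = mu_ext nu B].
Proof.
case: PhiP => -[_ iP sP] _ _ Pmu RA RB BA; have [B' RB' B'E] := sP B RB.
exists B'; split=> //; last by rewrite -B'E Pmu.
apply/setIidPl; apply: iP; rewrite ?inE //; first exact: RmuI.
by rewrite isoI // B'E; apply/setIidPl.
Qed.

(** Otherwise all subsets of [A] in [Rmu mu] have measure at most [r], while [Phi A] has a subset of
    larger measure. *)
Lemma iso_mem_gt A y r : Rmu mu A -> Phi A y -> 0 < r -> r < Nmu nu y ->
  exists2 x, A x & r < Nmu mu x.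
Proof.
move=> RA Ay r0 rN; apply: contrapT => Ar.
have [B [RB BA]] := lt_Nmu_mu_ext DT (iso_Rmu RA) Ay r0 rN.
have [B' [RB' B'A <-]] := iso_subset RA RB BA.
apply/negP; rewrite -leNgt (mu_ext_le_Nmu CT) //; first exact: ltW.
by move=> x /B'A Ax; rewrite leNgt; apply/negP => rx; apply: Ar; exists x.
Qed.

(* The ultrafilter [{A | Phi A y}] converges: otherwise the [U] in the ring with
   [Phi U y] would shrink to the empty set, while each of them has norm at least
   [Nmu nu y]. *)
Lemma iso_point y : Nmu nu y != 0 -> exists x, forall A, Rmu mu A ->
  (A x <-> Phi A y).
Proof.
move=> Ny; set s := Nmu nu y; have s0 : 0 < s by rewrite lt_def Ny Nmu_ge0.
have [s20 s2s] : 0 < s / 2 /\ s / 2 < s.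
  by have [] := midf_lt s0; rewrite add0r.
apply: contrapT => nx.
have sep x : exists A, [/\ Rmu mu A, ~ A x & Phi A y].
  have [A] : exists A, ~ (Rmu mu A -> (A x <-> Phi A y)).
    by apply/existsNP => h; apply: nx; exists x.
  move=> /not_implyP[RA AP].
  have [Ax|Ax] := pselect (A x); last first.
    by exists A; split=> //; apply: contrapT => PA; apply: AP.
  exists (~` A); split; [exact: RmuC|by move=> /(_ Ax)|].
  by rewrite isoC // => PA; apply: AP.
pose F := [set U | cring C U /\ Phi U y].
have FC : F `<=` cring C by move=> U [].
have sF : shrinking F.
  move=> U V [CU PU] [CV PV]; exists (U `&` V); split=> //; split;
    first by apply: cringI.
  by rewrite isoI //; exact: Rmu_cring.
have F0 : \bigcap_(A in F) A = set0.
  (* If [Nmu mu x < s], a neighbourhood [V] of norm below [s] cannot satisfy [Phi V y], so its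
     complement is in [F] and misses [x]. *)
  rewrite -subset0 => x Fx; have [Ns|sN] := ltP (Nmu mu x) s.
    have [V [CV Vx Vs]] := Nmu_lt Ns.
    have RV := Rmu_cring mu CT CV.
    have [PV|PV] := pselect (Phi V y).
      have [tr rs] := midf_lt Vs; set r := _ / _ in tr rs.
      have r0 : 0 < r by apply: le_lt_trans tr; exact: set_norm_ge0.
      have [z Vz] := iso_mem_gt RV PV r0 rs.
      apply/negP; rewrite -leNgt (le_trans (Nmu_le_set_norm mu CV Vz)) //;
        exact: ltW.
    have : F (~` V).
      by split; [rewrite -setTD; apply: cringD|rewrite isoC].
    by move=> /Fx/(_ Vx).
  have [A [RA Ax PA]] := sep x.
  (* The separating set [A] is replaced by a ring set [U] that agrees with it where [Nmu mu] exceeds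
     [s / 2], in particular at [x]. If [Phi U y] failed, [A] minus [U] would contain a point of that
     region. *)
  have /RmuP/(_ _ s20)[//|U [CU AU]] := RA.
  have RU := Rmu_cring mu CT CU.
  apply/Ax/(AU x (lt_le_trans s2s sN)).
  suff : F U by move/Fx.
  split=> //; apply: contrapT => PU.
  have RUC := RmuC CT RU; have RAU : Rmu mu (A `&` ~` U) by exact: RmuI.
  have [|z [Az Uz] /AU h] := iso_mem_gt RAU _ s20 s2s;
    first by rewrite isoI // isoC.
  exact/Uz/h.
have [U [[CU PU] Ue]] := na_mu_continuous mu FC sF F0 s20.
have RU := Rmu_cring mu CT CU.
have [z Uz sz] := iso_mem_gt RU PU s20 s2s.
have [B [CB BU sB]] := set_norm_gt CU (lt_le_trans sz (Nmu_le_set_norm mu CU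
  Uz)).
have RB := Rmu_cring mu CT CB.
(* Either [B] or its complement in [U] is in [F] and so has measure below [s / 2]; as [U] does too,
   both cases contradict [sB]. *)
have [PB|PB] := pselect (Phi B y).
  by have := lt_trans sB (Ue B (conj CB PB) BU); rewrite ltxx.
have CUB : cring C (U `\` B) by apply: cringD.
have : F (U `\` B).
  by split=> //; rewrite setDE isoI ?isoC //; exact: RmuC.
move=> /Ue/(_ (@subDsetl _ _ _)) UBs.
have muB : mu B = mu U - mu (U `\` B).
  by have /setIidPr UB := BU; rewrite (na_muID mu CU CB) addrK UB.
have Us := Ue U (conj CU PU) (@subset_refl _ _).
have : v (mu U - mu (U `\` B)) < s / 2.
  by rewrite (le_lt_trans (absval_ultra _ _ _)) // absvalN gt_max Us.
by rewrite -muB => /(lt_trans sB); rewrite ltxx.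
Qed.

Lemma iso_point_map (x0 : X) : exists phi, induces_iso phi.
Proof.
have /choice[phi phiP] : forall y, exists x, Nmu nu y != 0 ->
    forall A, Rmu mu A -> (A x <-> Phi A y).
  move=> y; have [_|Ny] := eqVneq (Nmu nu y) 0; first by exists x0.
  by have [x xP] := iso_point Ny; exists x.
by exists phi.
Qed.

Lemma induces_iso_Nmu_nondecreasing phi : induces_iso phi ->
  Nmu_nondecreasing_map mu nu phi.
Proof.
move=> phiP; split=> [A /(Rmu_cring mu CT) RA|y].
  by apply: (Rmu_Nmu0 DT (iso_Rmu RA)) => y Ny; apply: iff_sym; exact: phiP.
have [->|Ny] := eqVneq (Nmu nu y) 0; first exact: Nmu_ge0.
apply: Nmu_le_transport => // U CU Uy; have RU := Rmu_cring mu CT CU.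
exists (Phi U); split; [exact: iso_Rmu|exact/phiP|move=> B RB].
exact: iso_subset.
Qed.

End PointMap.

(** * The spectral isomorphism *)

Lemma cring_separated (X : Type) (C : covering_ring X) (x y : X) :
  (forall A, cring C A -> A x -> A y) -> x = y.
Proof.
by move=> xy; apply: contrapT => /(@cring_separating _ C)[A [CA Ax]]; apply;
  exact: xy.
Qed.

Theorem lemma3p6 (R : realType) (K : fieldType) (v : complete_absval R K)
  (X Y : Type) (C : covering_ring X) (D : covering_ring Y)
  (mu : na_measure v C) (nu : na_measure v D)
  (mu_prob : is_probability mu) (nu_prob : is_probability nu)
  (T : X -> X) (S : Y -> Y)
  (T_imp : invertible_measure_preserving mu T)
  (S_imp : invertible_measure_preserving nu S) :
  conjugate mu nu T S -> spectrally_isomorphic mu nu T S.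
Proof.
move=> [Phi PhiP PhiTS]; have [[CT _] [DT _]] := (mu_prob, nu_prob).
have [[x0 _] [y0 _]] :=
  (probability_inhabited mu_prob, probability_inhabited nu_prob).
pose Psi := pinv (Rmu mu) Phi.
have PsiP : measure_algebra_iso nu mu Psi := measure_algebra_iso_inv CT PhiP.
have [phi phiP] := iso_point_map CT DT PhiP x0.
have [psi psiP] := iso_point_map DT CT PsiP y0.
have phiN := induces_iso_Nmu_nondecreasing CT DT PhiP phiP.
have psiN := induces_iso_Nmu_nondecreasing DT CT PsiP psiP.
have TN := invertible_Nmu_nondecreasing CT T_imp.
have SN := invertible_Nmu_nondecreasing DT S_imp.
have PhiK A : Rmu mu A -> Psi (Phi A) = A by exact: (iso_pinvK PhiP).
have PsiK B : Rmu nu B -> Phi (Psi B) = B.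
  by case: PhiP => -[_ _ sP] _ _ _ /sP[A RA <-]; rewrite PhiK.
have neq0 (X' Y' : Type) (C' : covering_ring X') (D' : covering_ring Y')
    (mu' : na_measure v C') (nu' : na_measure v D') (h : Y' -> X') y :
    Nmu_nondecreasing_map mu' nu' h -> Nmu nu' y != 0 -> Nmu mu' (h y) != 0.
  move=> [_ /(_ y) hy]; apply: contraNN => /eqP h0.
  by rewrite eq_le Nmu_ge0 andbT -h0.
have phipsi x : Nmu mu x != 0 -> phi (psi x) = x.
  move=> Nx; apply: (@cring_separated _ C) => A /(Rmu_cring mu CT) RA.
  move/(phiP _ (neq0 _ _ _ _ _ _ _ _ psiN Nx) _ RA).
  by move/(psiP _ Nx _ (iso_Rmu PhiP RA)); rewrite PhiK.
have psiphi y : Nmu nu y != 0 -> psi (phi y) = y.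
  move=> Ny; apply: (@cring_separated _ D) => B /(Rmu_cring nu DT) RB.
  move/(psiP _ (neq0 _ _ _ _ _ _ _ _ phiN Ny) _ RB).
  by move/(phiP _ Ny _ (iso_Rmu PsiP RB)); rewrite PsiK.
have phiS y : Nmu nu y != 0 -> phi (S y) = T (phi y).
  move=> Ny; apply: (@cring_separated _ C) => A /(Rmu_cring mu CT) RA.
  have RPA := iso_Rmu PhiP RA.
  move/(phiP _ (neq0 _ _ _ _ _ _ _ _ SN Ny) _ RA) => PAS.
  have [[_ mS] _ _] := S_imp; have [RSA _] := mS _ RPA.
  (* Conjugacy at [Phi A] identifies the preimage of [Phi A] under [S] with the image under [Phi] of
     the preimage of [A] under [T]. *)
  have := PhiTS _ RPA; rewrite -/Psi PhiK // => TAE.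
  have RTA : Rmu mu (T @^-1` A) by rewrite -TAE; exact: (iso_Rmu PsiP).
  by apply/(phiP _ Ny _ RTA); rewrite -TAE PsiK.
have W_linear := pullback_linear phiN.
pose W : {linear L1 mu -> L1 nu} := HB.pack (pullback nu phi)
  (GRing.isLinear.Build _ _ _ _ _ W_linear).
pose W' := pullback mu psi : L1 nu -> L1 mu.
have WK f : W' (W f) = f.
  by elim/quotW: f => f; apply: (pullback_comp phiN psiN) => // x /phipsi ->.
have W'K g : W (W' g) = g.
  by elim/quotW: g => g; apply: (pullback_comp psiN phiN) => // y /psiphi ->.
exists W; split.
- by exists W'.
(* [W] and its inverse [W'] are both contractions, hence isometries. *)
- move=> f; apply/eqP; rewrite eq_le (L1_norm_pullback phiN) /=.
  by rewrite -{1}[f]WK (L1_norm_pullback psiN).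
- elim/quotW=> f; have [g gE] := Lmu_comp TN f.
  have [k kE] := Lmu_comp phiN g.
  rewrite /=.
  (* [koopman] unfolds to [pullback] of the same map, and both sides are the class of [k], which is
     [f \o T \o phi]. *)
  rewrite [LHS](pullback_comp (g := k) phiN SN); last first.
    by move=> y Ny; rewrite kE gE phiS.
  by rewrite [RHS](pullback_comp (g := k) TN phiN) // => y _; rewrite kE gE.
Qed.
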